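(* Let $j$ be a nonnegative integer and $n$ a nonnegative integer. Then \[\sum_{m\ge j} M(m,n)\] (the number of partitions of $n$ with crank at least $j$) equals the number of partitions $\lambda$ of $n$ for which $\mathrm{mex}_j(\lambda)$ is defined and $\mathrm{mex}_j(\lambda)-j$ is odd.
   Context: A partition of $n$ is a finite nonincreasing sequence of positive integers (parts) summing to $n$; $p(n)$ is the number of partitions of $n$, with $p(0)=1$. Write $(q)_\infty=\prod_{i\ge1}(1-q^i)$. For an integer $m$ and $n\ge 0$, $M(m,n)$ denotes the number of partitions of $n$ with crank $m$. In the convention used here, $M(m,n)$ is defined by Garvan's generating function \[\sum_{n\ge0} M(m,n)q^n=\frac{1}{(q)_\infty}\sum_{r\ge1}(-1)^{r-1}q^{r(r-1)/2+r|m|}(1-q^r).\] For $n\neq 1$ this agrees with the combinatorial (Andrews–Garvan) crank count; for $n=1$ it gives $M(\pm1,1)=1$, $M(0,1)=-1$, and $M(m,1)=0$ otherwise. For a partition $\lambda$ and a positive integer $j$ that is a part of $\lambda$, $\mathrm{mex}_j(\lambda)$ is the least integer greater than $j$ that is not a part of $\lambda$. If $j$ is not a part of $\lambda$, then $\mathrm{mex}_j(\lambda)$ is undefined. For $j=0$, $0$ is regarded as a part of every partition, so $\mathrm{mex}_0(\lambda)$ is the smallest positive integer that is not a part of $\lambda$ (the mex of $\lambda$). *)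

(* Defs.v *)
From HB Require Import structures.
From mathcomp Require Import all_boot all_order all_algebra.
From mathcomp Require Import boolp classical_sets fsbigop.

Set Implicit Arguments.
Unset Strict Implicit.
Unset Printing Implicit Defensive.

Import Order.TTheory GRing.Theory Num.Theory.

Definition is_part_of (n : nat) (s : seq nat) : bool :=
  [&& sorted geq s, 0 \notin s & sumn s == n].

Record intpartn (n : nat) : Type := IntPartN {
  parts :> seq nat;
  partsP : is_part_of n parts
}.

HB.instance Definition _ n := [isSub of intpartn n for @parts n].
HB.instance Definition _ n := [Countable of intpartn n by <:].

Section IntPartFinite.
Variable n : nat.

Lemma leq_sumn_mem (s : seq nat) x : x \in s -> x <= sumn s.
Proof.
elim: s => //= y s IHs; rewrite inE => /orP[/eqP-> | /IHs]; first exact: leq_addr.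
by move=> /leq_trans-> //; exact: leq_addl.
Qed.

Lemma size_leq_sumn (s : seq nat) : 0 \notin s -> size s <= sumn s.
Proof.
elim: s => //= y s IHs; rewrite inE negb_or eq_sym -lt0n => /andP[y0 /IHs].
by rewrite -add1n; exact: leq_add.
Qed.

Lemma intpartn_size (la : intpartn n) : size (map (@inord n) la) <= n.
Proof.
by case: la => s /= /and3P[_ s0 /eqP <-]; rewrite size_map size_leq_sumn.
Qed.

Definition intpartn_code (la : intpartn n) : n.-bseq 'I_n.+1 :=
  Bseq (intpartn_size la).
Definition intpartn_decode (b : n.-bseq 'I_n.+1) : option (intpartn n) :=
  insub (map val b).

Lemma intpartn_codeK : pcancel intpartn_code intpartn_decode.
Proof.
move=> la; rewrite /intpartn_decode /=.
have -> : map val (map (@inord n) la) = parts la.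
  rewrite -map_comp -[RHS]map_id; apply/eq_in_map => x xla /=.
  have /and3P[_ _ /eqP def_n] := partsP la.
  by rewrite inordK // ltnS (leq_trans (leq_sumn_mem xla)) ?def_n.
exact: valK.
Qed.

End IntPartFinite.

HB.instance Definition _ n : isFinite (intpartn n) :=
  PCanIsFinite (@intpartn_codeK n).

Lemma mex_subproof (j : nat) (s : seq nat) :
  exists k, (j < k) && (k \notin s).
Proof.
exists (j + sumn s).+1; rewrite ltnS leq_addr /=.
by apply/negP => /leq_sumn_mem; rewrite leqNgt ltnS leq_addl.
Qed.

(* None encodes "undefined"; 0 counts as a part of every partition. *)
Definition mex (j : nat) (s : seq nat) : option nat :=
  if (j == 0) || (j \in s) then Some (ex_minn (mex_subproof j s)) else None.

Definition mex_odd (j : nat) (s : seq nat) : bool :=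
  if mex j s is Some k then odd (k - j) else false.

Local Open Scope ring_scope.

(* Formal power series over int are represented by their coefficient
   sequences. *)
Definition fps := nat -> int.

Definition fps_mul (f g : fps) : fps :=
  fun n => \sum_(i < n.+1) f i * g (n - i)%N.

(* fps_inv_rev f n = [:: g_n; ...; g_0], where g_0 = 1 and
   g_n = - (f_1 g_(n-1) + ... + f_n g_0) are the coefficients of 1/f. *)
Fixpoint fps_inv_rev (f : fps) (n : nat) : seq int :=
  if n is n'.+1 then
    let s := fps_inv_rev f n' in - (\sum_(i < n) f i.+1 * s`_i) :: s
  else [:: 1].

(* The inverse of f, meaningful when the constant coefficient of f is 1. *)
Definition fps_inv (f : fps) : fps := fun n => head 0 (fps_inv_rev f n).

Lemma fps_inv_revE f n (i : nat) :
  (i <= n)%N -> (fps_inv_rev f n)`_i = fps_inv f (n - i)%N.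
Proof.
elim: n i => [|n IHn] [|i] //= lein.
by rewrite subSS IHn.
Qed.

Lemma fps_mulV f : f 0%N = 1 -> fps_mul f (fps_inv f) =1 fun n => (n == 0%N)%:R.
Proof.
move=> f0 [|n]; rewrite /fps_mul big_ord_recl f0 mul1r subn0.
  by rewrite big_ord0 addr0.
rewrite {1}/fps_inv /= addrC; apply/eqP; rewrite subr_eq0; apply/eqP.
by apply: eq_bigr => i _; rewrite fps_inv_revE ?subSS // -ltnS.
Qed.

Definition qpoch_poly (N : nat) : {poly int} := \prod_(1 <= i < N.+1) (1 - 'X^i).

(* The infinite product (q)_oo: factors with index i > n do not contribute to
   the coefficient of q^n, see qpoch_stable. *)
Definition qpoch : fps := fun n => (qpoch_poly n)`_n.

Lemma qpoch_stable n N : (n <= N)%N -> (qpoch_poly N)`_n = qpoch n.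
Proof.
move/subnKC <-; elim: (N - n)%N => [|k IHk]; first by rewrite addn0.
rewrite addnS -{}IHk /qpoch_poly big_nat_recr //= mulrBr mulr1 coefB.
by rewrite coefMXn ltnS leq_addr subr0.
Qed.

Lemma qpoch0 : qpoch 0%N = 1.
Proof. by rewrite /qpoch /qpoch_poly big_nil coef1. Qed.

Definition garvan_term (m : int) (r : nat) : {poly int} :=
  (-1) ^+ r.-1 * 'X^((r * r.-1)./2 + r * `|m|%N) * (1 - 'X^r).

(* The series sum_(r >= 1) garvan_term m r: terms with index r > n + 1 do not
   contribute to the coefficient of q^n, see garvan_sum_stable. *)
Definition garvan_sum (m : int) : fps :=
  fun n => (\sum_(1 <= r < n.+2) garvan_term m r)`_n.

Lemma coef_garvan_term m r n :
  (n < (r * r.-1)./2 + r * `|m|)%N -> (garvan_term m r)`_n = 0.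
Proof.
move=> ltn; rewrite /garvan_term -mulrA mulrCA mulrC coefMXn.
by rewrite ltn.
Qed.

Lemma garvan_sum_stable m n N :
  (n < N)%N -> (\sum_(1 <= r < N.+1) garvan_term m r)`_n = garvan_sum m n.
Proof.
move/subnKC <-; elim: (N - n.+1)%N => [|k IHk]; first by rewrite addn0.
rewrite addnS -{}IHk big_nat_recr //= coefD coef_garvan_term ?addr0 //.
set t := (n.+1 + k)%N; apply: ltn_addr.
have lent : (n < t)%N by rewrite leq_addr.
rewrite -[t.+1.-1]/t (leq_trans lent) // geq_half_double -mul2n leq_mul2r.
by rewrite ltnS (leq_ltn_trans _ lent) ?orbT.
Qed.

(* crankM m n = M(m, n), in the convention where M(-1, 1) = M(1, 1) = 1 and
   M(0, 1) = -1. *)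
Definition crankM (m : int) : fps := fps_mul (fps_inv qpoch) (garvan_sum m).

(* For fixed n, M(m, n) has finite support in m. *)
Lemma crankM_eq0 m n : (n < `|m|)%N -> crankM m n = 0.
Proof.
move=> ltnm; apply: big1 => i _; rewrite [X in _ * X](_ : _ = 0) ?mulr0 //.
rewrite /garvan_sum coef_sum big_nat_cond big1 // => r /andP[/andP[r0 _] _].
apply: coef_garvan_term; apply: leq_ltn_trans (leq_subr _ _) _.
by apply: leq_trans ltnm (leq_trans (leq_pmull _ r0) (leq_addl _ _)).
Qed.

(* Main.v *)
(* Summing Garvan's series over m >= j telescopes to
   1/(q)_oo * sum_(r >= 0) (-1)^r q^(j + (j+1) + ... + (j+r)).
   Deleting one copy of each of j, ..., j+r shows that the r-th term counts,
   up to sign, the partitions containing all of j, ..., j+r, i.e. those with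
   r < mex_j - j; the alternating sum over these r is 1 if mex_j - j is odd
   and 0 otherwise. *)

Require Import Defs.
From mathcomp Require Import all_boot all_order all_algebra.
From mathcomp Require Import boolp classical_sets fsbigop.
From mathcomp Require Import zify.

Import GRing.Theory.

(** * Counting partitions with a given property *)

Definition npart (P : pred (seq nat)) (n : nat) : nat :=
  #|[set la : intpartn n | P la]%SET|.

Lemma eq_npart (P Q : pred (seq nat)) n :
  (forall s, is_part_of n s -> P s = Q s) -> npart P n = npart Q n.
Proof. by move=> PQ; apply: eq_card => la; rewrite !inE PQ ?partsP. Qed.

Lemma npart_split (P Q : pred (seq nat)) n :
  npart P n = npart (predI Q P) n + npart (predI (predC Q) P) n.
Proof.
rewrite /npart -(cardsID [set la : intpartn n | Q la]%SET).
by congr (_ + _); apply: eq_card => la; rewrite !inE //= andbC.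
Qed.

Lemma npart_oversize k n (P : pred (seq nat)) :
  n < k -> npart (predI (fun s => k \in s) P) n = 0.
Proof.
move=> ltnk; apply/eqP; rewrite cards_eq0 -finset.subset0.
apply/fintype.subsetP => la; rewrite inE => /andP[/leq_sumn_mem].
by have /and3P[_ _ /eqP->] := partsP la; rewrite leqNgt ltnk.
Qed.

(** * Inserting and deleting a part *)

Lemma is_part_of_add k n s :
  0 < k -> is_part_of n s -> is_part_of (k + n) (sort geq (k :: s)).
Proof.
move=> k0 /and3P[_ s0 /eqP <-]; apply/and3P; split.
- by apply: sort_sorted => x y; exact: leq_total.
- by rewrite mem_sort inE negb_or eq_sym -lt0n k0.
- by rewrite (perm_sumn (permEl (perm_sort geq (k :: s)))).
Qed.

Lemma is_part_of_rem k n s :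
  k \in s -> is_part_of (k + n) s -> is_part_of n (rem k s).
Proof.
move=> ks /and3P[ss s0 /eqP sn]; apply/and3P; split.
- apply: (subseq_sorted _ (rem_subseq k s) ss) => y x z /= xy yz.
  exact: leq_trans yz xy.
- by apply: contra s0 => /mem_rem.
- by have := perm_sumn (perm_to_rem ks); rewrite sn /= => /addnI ->.
Qed.

Lemma geq_sorted_perm_eq {s t : seq nat} :
  sorted geq s -> sorted geq t -> perm_eq s t -> s = t.
Proof.
apply: sorted_eq => [y x z /= xy yz|x y]; first exact: leq_trans yz xy.
by rewrite /= -eqn_leq => /eqP.
Qed.

(** Inserting [k] and sorting is a bijection whose inverse is [rem k]. Since [P] ignores order, the
    unsorted [k :: s] can stand for the enlarged partition. *)
Lemma npart_add_part k n (P : pred (seq nat)) :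
    0 < k -> (forall s t, perm_eq s t -> P s = P t) ->
  npart (predI (fun s => k \in s) P) (k + n) = npart (fun s => P (k :: s)) n.
Proof.
move=> k0 permP.
pose add (la : intpartn n) := IntPartN (is_part_of_add k n la k0 (partsP la)).
have add_inj : injective add.
  move=> la mu /(congr1 (@parts _)) /= eq_add; apply/val_inj/geq_sorted_perm_eq.
  - by case/and3P: (partsP la).
  - by case/and3P: (partsP mu).
  rewrite -(perm_cons k) -(perm_sort geq) eq_add perm_sym.
  by rewrite perm_sym perm_sort.
rewrite /npart -(card_imset _ add_inj); apply: eq_card => la; rewrite inE /=.
apply/andP/imsetP => [[kla Pla]|[mu]].
  exists (IntPartN (is_part_of_rem k n la kla (partsP la))).
    by rewrite inE /= -(permP _ _ (perm_to_rem kla)).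
  apply/val_inj/geq_sorted_perm_eq => /=.
  - by case/and3P: (partsP la).
  - by apply: sort_sorted => x y; exact: leq_total.
  by rewrite perm_sym perm_sort perm_sym perm_to_rem.
rewrite inE => Pmu ->; rewrite mem_sort mem_head; split=> //=.
by rewrite (permP _ (k :: mu)) // perm_sort.
Qed.

(** The entries of [s] are deleted one at a time. As [s] has no repetition, deleting one copy of [k]
    does not affect whether the other entries are present. *)
Lemma npart_contains s n :
    uniq s -> 0 \notin s ->
  npart (fun t => all (mem t) s) n
    = if sumn s <= n then npart predT (n - sumn s) else 0.
Proof.
elim: s n => [|k s IHs] n /=; first by rewrite subn0.
case/andP=> ks us; rewrite inE negb_or eq_sym -lt0n => /andP[k0 s0].
have [lekn|ltnk] := leqP k n; last first.
  rewrite leqNgt (leq_trans ltnk (leq_addr _ _)) /=.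
  exact: (npart_oversize k n (fun t => all (mem t) s)).
rewrite -[in LHS](subnKC lekn).
rewrite (npart_add_part k _ (fun t => all (mem t) s)) //; last first.
  by move=> t u /perm_mem tu; apply: eq_all => x /=; rewrite tu.
rewrite -leq_subRL // subnDA -IHs //; apply: eq_npart => t _.
apply: eq_in_all => x xs /=; rewrite inE; case: eqP => // xk.
by rewrite -xk xs in ks.
Qed.

(** * The partition generating function as the inverse of (q)_oo *)

Lemma npart_bounded_rec N n :
  npart (all (fun x => x <= N.+1)) n
    = npart (all (fun x => x <= N)) n
      + (if N.+1 <= n then npart (all (fun x => x <= N.+1)) (n - N.+1) else 0).
Proof.
rewrite (npart_split _ (fun s => N.+1 \in s)) addnC; congr (_ + _).
  apply: eq_npart => s _ /=; apply/andP/allP => [[sN /allP s_le] x xs|s_le].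
    rewrite -ltnS ltn_neqAle; apply/andP; split; last exact: s_le.
    by apply: contraNneq sN => <-.
  split; last by apply/allP => x /s_le /leqW.
  by apply/negP => /s_le; rewrite ltnn.
have [leN|ltN] := leqP N.+1 n; last exact: npart_oversize.
rewrite -[in LHS](subnKC leN) npart_add_part //; last first.
  by move=> s t; exact: perm_all.
by apply: eq_npart => s _ /=; rewrite leqnn.
Qed.

Lemma npart_bounded0 n : npart (all (fun x => x <= 0)) n = (n == 0).
Proof.
rewrite (eq_npart _ (fun s => nilp s && (n == 0))) => [|s /and3P[_ s0 /eqP <-]].
  have [n0|n_neq0] := eqVneq n 0; last first.
    by apply: eq_card0 => la; rewrite inE andbF.
  have p0 : is_part_of n [::] by rewrite /is_part_of n0.
  rewrite -[RHS](cards1 (IntPartN p0)); apply: eq_card => la; rewrite !inE andbT.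
  by apply/nilP/eqP => [la_nil|->//]; apply/val_inj.
case: s s0 => //= x s; rewrite inE negb_or eq_sym => /andP[x0 _].
by rewrite leqn0 (negPf x0).
Qed.

Local Open Scope ring_scope.

(** Induction on [N]: by [npart_bounded_rec], the new factor [1 - 'X^N.+1] turns the generating
    function for parts at most [N.+1] into the one for parts at most [N]. *)
Lemma qpoch_poly_npart N n :
  \sum_(i < n.+1) (qpoch_poly N)`_i
      * (npart (all (fun x => x <= N)%N) (n - i))%:Z = (n == 0%N)%:R.
Proof.
elim: N n => [|N IHN] n.
  rewrite big_ord_recl big1 => [|i _]; rewrite /qpoch_poly big_nil coef1 ?mul0r //.
  by rewrite mul1r addr0 subn0 npart_bounded0; case: eqP.
(* Truncating at degree [n] gives polynomials, so the convolution becomes a coefficient of a product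
   and associativity applies. *)
pose F K := \poly_(i < n.+1) (npart (all (fun x => x <= K)%N) i)%:Z.
have coefF (Q : {poly int}) K : \sum_(i < n.+1) Q`_i
      * (npart (all (fun x => x <= K)%N) (n - i))%:Z = (Q * F K)`_n.
  by rewrite coefM; apply: eq_bigr => i _; rewrite coef_poly ltnS leq_subr.
rewrite coefF /qpoch_poly big_nat_recr //= -mulrA -IHN coefF.
rewrite !coefM; apply: eq_bigr => i _; congr (_ * _).
rewrite mulrBl mul1r coefB coefXnM !coef_poly !ltnS leq_subr.
rewrite npart_bounded_rec; case: ltnP => [_|leN]; last by rewrite addn0 subr0.
by rewrite PoszD (leq_trans (leq_subr _ _) (leq_subr _ _)) addrK.
Qed.

(** Partitions of numbers up to [n] have no part above [n], so the case [N = n] of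
    [qpoch_poly_npart] applies. *)
Lemma qpoch_npart n :
  fps_mul qpoch (fun k => (npart predT k)%:Z) n = (n == 0%N)%:R.
Proof.
rewrite -(qpoch_poly_npart n); apply: eq_bigr => i _.
rewrite qpoch_stable -1?ltnS //; congr (_ * _%:Z).
apply: eq_npart => s /and3P[_ _ /eqP sn]; apply/esym/allP => x /leq_sumn_mem.
by rewrite sn => /leq_trans; apply; exact: leq_subr.
Qed.

(** As [f 0 = 1], the [n]-th coefficient of the product is [g n] plus terms in earlier coefficients
    of [g]. *)
Lemma fps_mul_inj f g h :
  f 0%N = 1 -> fps_mul f g =1 fps_mul f h -> g =1 h.
Proof.
move=> f0 eq_fgh n; elim/ltn_ind: n => n IHn; have := eq_fgh n.
rewrite /fps_mul !big_ord_recl f0 !mul1r subn0.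
rewrite (eq_bigr (fun i : 'I_n => f (lift ord0 i) * h (n - lift ord0 i)%N)).
  exact: addIr.
by move=> i _; rewrite IHn // lift0; have := ltn_ord i; lia.
Qed.

Lemma fps_inv_qpoch : fps_inv qpoch =1 fun n => (npart predT n)%:Z.
Proof.
apply: (fps_mul_inj _ _ _ qpoch0) => n.
by rewrite qpoch_npart fps_mulV ?qpoch0.
Qed.

(** * Telescoping Garvan's series *)

Lemma sumn_iota j r : sumn (iota j r) = ((r * r.-1)./2 + r * j)%N.
Proof.
rewrite -bin2; elim: r j => [|r IHr] j //=.
by rewrite IHr binS bin1 mulSn mulnS; lia.
Qed.

(** Raising [m >= 0] by one multiplies [garvan_term m r.+1] by ['X^r.+1], so its factor
    [1 - 'X^r.+1] makes the sum telescope. *)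
Lemma sum_garvan_term (j N r : nat) :
  \sum_(i < N) garvan_term (j + i)%N r.+1
    = (-1) ^+ r * 'X^(sumn (iota j r.+1)) * (1 - 'X^(r.+1 * N)).
Proof.
rewrite sumn_iota.
elim: N => [|N IHN]; first by rewrite big_ord0 muln0 expr0 subrr mulr0.
rewrite big_ord_recr /= IHN /garvan_term -[`|_|%N]/(j + N)%N -!mulrA -!mulrDr.
rewrite mulnDr addnA [in 'X^(_ + r.+1 * N)]exprD -mulrA -mulrDr.
by rewrite mulrBr mulr1 -exprD addrA subrK -mulnSr.
Qed.

Lemma sum_garvan_sum (j N k : nat) : (k < N)%N ->
  \sum_(i < N) garvan_sum (j + i)%N k
    = \sum_(r < N) (-1) ^+ r * (k == sumn (iota j r.+1))%:R.
Proof.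
move=> ltkN; under eq_bigr do rewrite -(garvan_sum_stable _ ltkN).
rewrite -coef_sum exchange_big big_add1 big_mkord coef_sum.
apply: eq_bigr => r _; rewrite sum_garvan_term mulrBr mulr1 coefB.
(* The end term of the telescoping is a multiple of ['X^(r.+1 * N)], and [k < N <= r.+1 * N]. *)
rewrite [X in _ - X]coefMXn (leq_trans ltkN) ?leq_pmull // subr0.
rewrite -!(signr_odd _ r).
by case: odd; rewrite !(expr0, expr1, mulN1r, mul1r, coefN) coefXn.
Qed.

(** * Mex parity as an alternating sum *)

Lemma sum_npart (P : pred (seq nat)) n :
  (npart P n)%:Z = \sum_(la : intpartn n) (P la)%:R.
Proof.
rewrite /npart -sum1_card big_mkcond -natz natr_sum.
by apply: eq_bigr => la _; rewrite inE; case: (P la).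
Qed.

(* The extra 0 makes j = 0 a part of every partition, as in the definition of
   mex_0. *)
Lemma npart_contains_iota j r n :
  npart (fun s => all (mem (0%N :: s)) (iota j r)) n
    = if (sumn (iota j r) <= n)%N then npart predT (n - sumn (iota j r)) else 0%N.
Proof.
(* [npart_contains] needs positive entries; a zero, possible only for [j = 0], adds nothing to the
   sum and always lies in [0 :: s]. *)
have -> : sumn (iota j r) = sumn [seq x <- iota j r | 0 < x]%N.
  by elim: (iota j r) => [|[|x] s IHs] //=; rewrite IHs.
rewrite -npart_contains ?filter_uniq ?iota_uniq ?mem_filter //.
apply: eq_npart => s _; rewrite all_filter; apply: eq_all => x /=.
by rewrite inE; case: x.
Qed.

Lemma sum_sign_ltn (K N : nat) : (K <= N)%N ->
  \sum_(r < N) (-1) ^+ r * (r < K)%:R = (odd K)%:R :> int.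
Proof.
move=> leKN; have {leKN} ->:
    \sum_(r < N) (-1) ^+ r * (r < K)%:R = \sum_(r < K) (-1) ^+ r :> int.
  rewrite (big_ord_widen _ (fun r => (-1) ^+ r) leKN) [RHS]big_mkcond.
  by apply: eq_bigr => r _; case: ltnP; rewrite ?mulr1 ?mulr0.
elim: K => [|K IHK]; first by rewrite big_ord0.
by rewrite big_ord_recr /= IHK -signr_odd; case: odd.
Qed.

(** If the mex is [k], the [r]-th indicator is 1 exactly when [r < k - j], which reduces the claim
    to [sum_sign_ltn]. If it is undefined, every indicator vanishes, since each range starts at
    [j]. *)
Lemma mex_odd_sum j n s : is_part_of n s ->
  (mex_odd j s)%:R
    = \sum_(r < n.+1) (-1) ^+ r * (all (mem (0%N :: s)) (iota j r.+1))%:R :> int.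
Proof.
move=> /and3P[_ s0 /eqP sn]; rewrite /mex_odd /mex.
have -> : (j == 0%N) || (j \in s) = (j \in 0%N :: s) by rewrite inE.
case: ifP => [js|/negbT js]; last first.
  by rewrite big1 // => r _; rewrite /= (negPf js) mulr0.
case: ex_minnP => k /andP[ltjk ks] min_k.
have in_s x : (j < x < k)%N -> x \in s.
  move=> /andP[ltjx ltxk]; apply: contraLR ltxk => xs.
  by rewrite -leqNgt min_k // ltjx.
(* Otherwise [j + n.+1] would lie strictly between [j] and the mex, hence be a part larger than the
   total [n]. *)
have le_k : (k - j <= n.+1)%N.
  rewrite leqNgt; apply/negP => lt_k.
  have /in_s/leq_sumn_mem : (j < j + n.+1 < k)%N by lia.
  by rewrite sn; lia.
rewrite -(sum_sign_ltn _ _ le_k); apply: eq_bigr => r _; congr (_ * _%:R).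
rewrite ltn_subRL; congr nat_of_bool; apply/idP/allP => [ltrk x|all_s].
  rewrite mem_iota => /andP[]; rewrite leq_eqVlt => /predU1P[<-//|ltjx ltx].
  by apply/predU1r/in_s; lia.
rewrite ltnNge; apply: contra ks => lekr.
have : k \in 0%N :: s by apply: all_s; rewrite mem_iota; lia.
by rewrite inE; case: eqP => // k0; lia.
Qed.

(** * Comparing the crank and mex counts term by term *)

Local Open Scope classical_set_scope.

Theorem theorem2 (j n : nat) :
  \sum_(m \in [set m : int | j%:Z <= m]) crankM m n
    = #|[set la : intpartn n | mex_odd j la]%SET|%:Z.
Proof.
(* Cranks above [n] contribute 0, so [j, ..., j + n] suffice; these [n.+1] values also let
   [sum_garvan_sum] apply at every degree up to [n]. *)
pose ms := [seq Posz (j + i) | i <- index_iota 0 n.+1].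
rewrite (fsbigE ms); first last.
- case=> // m /= lejm; rewrite -[m](subnKC lejm) mem_map; last first.
    by move=> x y [/addnI].
  by rewrite mem_index_iota /= => ?; apply: crankM_eq0 => /=; lia.
- by move=> m /mapP[i _ ->] /=; rewrite lez_nat leq_addr.
- by rewrite map_inj_uniq ?iota_uniq // => x y [/addnI].
rewrite big_map (eq_bigl predT) => [|i]; last first.
  by apply: mem_set; rewrite /= lez_nat leq_addr.
rewrite big_mkord exchange_big /=.
under eq_bigr => a _.
  rewrite -mulr_sumr sum_garvan_sum ?ltnS ?leq_subr // mulr_sumr.
  under eq_bigr do rewrite mulrCA.
  over.
rewrite exchange_big -[RHS]/(npart (mex_odd j) n)%:Z sum_npart.
under [RHS]eq_bigr do rewrite (mex_odd_sum _ _ _ (partsP _)).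
(* For each [r], the left side is now the coefficient of [q^n] in [q^t / (q)_oo], up to the common
   sign, with [t] the sum of [j, ..., j + r]. *)
rewrite [RHS]exchange_big; apply: eq_bigr => r _.
rewrite -!mulr_sumr; congr (_ * _).
rewrite -(sum_npart (fun s => all (mem (0%N :: s)) (iota j r.+1))).
rewrite npart_contains_iota; set t := sumn _.
have [letn|ltnt] := leqP t n; last first.
  by apply: big1 => a _; rewrite (_ : (_ == _) = false) ?mulr0 //; lia.
(* Only the index [a = n - t] satisfies [n - a = t]. *)
rewrite (bigD1 (inord (n - t))) //= inordK ?ltnS ?leq_subr // subKn // eqxx.
rewrite mulr1 fps_inv_qpoch big1 ?addr0 // => a /eqP neq_a.
rewrite (_ : (_ == _) = false) ?mulr0 //; apply/eqP => eq_t; apply: neq_a.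
by apply/val_inj; rewrite /= inordK; have := ltn_ord a; lia.
Qed.
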